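(* Let $G=(\Sigma,S,s_0,\delta)$ be a regular commutative grammar and let $K\in\mathbb{N}^\Sigma$. Then $K\in\mathrm{out}(G)$ if and only if there exist a run $D$ of $G$ with $\|D\| = O(|S|^{2|\Sigma|}\,|\Sigma|!)$ (the implicit constant being independent of $G$ and $K$), and simple cycles $C_1,\ldots,C_m\in\mathcal{C}_{\mathrm{supp}(D)}$ such that $C_1,\ldots,C_m$ are linearly independent and $K=\mathrm{out}(D)+\sum_{i=1}^m \alpha^i\,\mathrm{out}(C_i)$ for some $\alpha^1,\ldots,\alpha^m\in\mathbb{N}$.
   Context: For a finite set $X$, elements of $\mathbb{N}^X$ are multisets over $X$; for $v\in\mathbb{Q}^X$, $|v|=\sum_{x}|v(x)|$ and $\|v\|=\max_x|v(x)|$. A commutative grammar is $G=(\Sigma,S,s_0,\delta)$ where $\Sigma$ is a finite alphabet, $S$ a finite set of states, $s_0\in S$ the initial state, and $\delta\subseteq S\times\mathbb{N}^\Sigma\times\mathbb{N}^S$ a finite set of transitions; a transition $\tau=(s,a,t)$ has $\mathrm{source}(\tau)=s$, $\mathrm{out}(\tau)=a$, $\mathrm{target}(\tau)=t$. It is assumed that every state is the source of some transition and that every transition satisfies $|a|\le 1$, $|t|\le 2$. The grammar is regular if $|t|\le 1$ for every transition. For $D\in\mathbb{N}^\delta$: $\mathrm{source}(D)(s)=\sum_{\tau:\mathrm{source}(\tau)=s}D(\tau)$, $\mathrm{out}(D)=\sum_\tau D(\tau)\mathrm{out}(\tau)$, $\mathrm{target}(D)=\sum_\tau D(\tau)\mathrm{target}(\tau)$,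 and $\mathrm{supp}(D)=\{s\in S:\mathrm{source}(D)(s)>0\}$. $D$ is connected from $s$ if for every $t\in\mathrm{supp}(D)$, either $t=s$ or there are transitions $\tau_1,\ldots,\tau_m$ with $D(\tau_i)>0$, $\mathrm{source}(\tau_1)=s$, $\mathrm{source}(\tau_{i+1})\in\mathrm{target}(\tau_i)$ and $t\in\mathrm{target}(\tau_m)$. $D$ is a cycle from $s$ if it is connected from $s$ and $\mathrm{source}(D)=\mathrm{target}(D)$; $D$ is a run if it is connected from $s_0$ and $\mathrm{source}(D)=\mathrm{target}(D)+\{s_0\}$. $\mathrm{out}(G)=\{\mathrm{out}(D): D \text{ a run of } G\}$. A simple cycle is a nonzero cycle that cannot be written as a sum of smaller nonzero cycles; $\mathcal{C}_s$ is the set of simple cycles from $s$, and $\mathcal{C}_T=\bigcup_{s\in T}\mathcal{C}_s$ for $T\subseteq S$. *)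

(* Defs.v *)
From HB Require Import structures.
From mathcomp Require Import all_boot all_order all_algebra.
Set Implicit Arguments. Unset Strict Implicit. Unset Printing Implicit Defensive.
Import Order.TTheory GRing.Theory Num.Theory.

(* A commutative grammar over the alphabet Sigma: finite set of states,
   initial state, and a finite set of transitions given by a finite type
   [trans] together with its source/out/target maps (injectivity of the
   triple map, required in [wf_grammar], makes it a genuine subset of
   S x N^Sigma x N^S). *)
Record grammar (Sigma : finType) := Grammar {
  state : finType;
  trans : finType;
  s0 : state;
  src : trans -> state;
  outt : trans -> {ffun Sigma -> nat};
  tgt : trans -> {ffun state -> nat}
}.

Section Defs.
Variables (Sigma : finType) (G : grammar Sigma).
Local Notation S := (state G).
Local Notation T := (trans G).

Definition size1 (X : finType) (v : {ffun X -> nat}) : nat := \sum_x v x.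

Definition wf_grammar : Prop :=
  [/\ injective (fun t : T => (src t, outt t, tgt t)),
      (forall s : S, exists t : T, src t = s),
      (forall t : T, size1 (outt t) <= 1) &
      (forall t : T, size1 (tgt t) <= 2)].

Definition regular : Prop := forall t : T, size1 (tgt t) <= 1.

Definition sourceD (D : {ffun T -> nat}) : {ffun S -> nat} :=
  [ffun s => \sum_(t | src t == s) D t].
Definition outD (D : {ffun T -> nat}) : {ffun Sigma -> nat} :=
  [ffun a => \sum_t D t * outt t a].
Definition targetD (D : {ffun T -> nat}) : {ffun S -> nat} :=
  [ffun s => \sum_t D t * tgt t s].
Definition supp (D : {ffun T -> nat}) : {set S} := [set s | 0 < sourceD D s].

Definition normD (D : {ffun T -> nat}) : nat := \max_t D t.

Definition connected_from (D : {ffun T -> nat}) (s : S) : Prop :=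
  forall u, u \in supp D ->
    u = s \/
    exists (t1 : T) (p : seq T),
      [/\ 0 < D t1, all (fun t => 0 < D t) p, src t1 = s,
          path (fun t t' => 0 < tgt t (src t')) t1 p &
          0 < tgt (last t1 p) u].

Definition cycle_from (D : {ffun T -> nat}) (s : S) : Prop :=
  connected_from D s /\ sourceD D = targetD D.

Definition is_cycle (D : {ffun T -> nat}) : Prop := exists s, cycle_from D s.

Definition is_run (D : {ffun T -> nat}) : Prop :=
  connected_from D (s0 G) /\
  forall s, sourceD D s = targetD D s + (s == s0 G).

Definition in_out (K : {ffun Sigma -> nat}) : Prop :=
  exists D, is_run D /\ outD D = K.

Definition smaller (C' C : {ffun T -> nat}) : Prop :=
  (forall t, C' t <= C t) /\ C' <> C.

Definition simple_cycle (C : {ffun T -> nat}) : Prop :=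
  [/\ C <> [ffun => 0], is_cycle C &
      ~ exists cs : seq {ffun T -> nat},
          [/\ (forall c, c \in cs -> [/\ c <> [ffun => 0], is_cycle c & smaller c C]) &
              forall t, C t = \sum_(c <- cs) c t]].

Definition simple_cycle_in (A : {set S}) (C : {ffun T -> nat}) : Prop :=
  simple_cycle C /\ exists2 s, s \in A & cycle_from C s.

Definition lin_indep (m : nat) (C : 'I_m -> {ffun T -> nat}) : Prop :=
  forall lam : 'I_m -> rat,
    (forall t, (\sum_i lam i * ((C i t)%:R : rat) = 0)%R) -> forall i, lam i = 0%R.

End Defs.
Arguments in_out {Sigma} G K.
Arguments is_run {Sigma} G D.
Arguments supp {Sigma} G D.
Arguments outD {Sigma} G D.
Arguments normD {Sigma} G D.
Arguments lin_indep {Sigma} G {m} C.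
Arguments simple_cycle_in {Sigma} G A C.
Arguments wf_grammar {Sigma} G.
Arguments regular {Sigma} G.

(* Main.v *)
Require Import Defs.
From mathcomp Require Import all_boot all_order all_algebra.
From mathcomp Require Import perm zify ring.
Set Implicit Arguments. Unset Strict Implicit. Unset Printing Implicit Defensive.
Import Order.TTheory GRing.Theory Num.Theory.

(* Redirecting terminal transitions to s0 turns a run into a circulation that
   uses exactly one terminal transition, and circulations are sums of elementary
   cycles, which use each transition at most once and have outputs of size at
   most n = |S|.  Keep a connected part D0 of the run, made of the terminating
   cycle and of fewer than n others covering the whole support, and group the
   remaining cycles by output vector, with multiplicities g(w).  Maximise the sum
   of the g(w)^2 while keeping the total output: a dependency beta among the w
   with g(w) >= n^k, k = |Sigma|, with integer coefficients at most n^k in absolute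
   value (Cramer's rule; determinants are bounded by products of l1-norms of
   rows), could be added to or subtracted from g, and one of the two would
   increase the sum.  So the w with g(w) >= n^k are independent; the other cycles
   join D0 and cost at most (n+1)^k n^k, which is at most 2 n^(2k) k!. *)

(** * Determinant bounds and integer dependencies with small coefficients *)

Section SmallDependency.
Local Open Scope ring_scope.

Lemma ler_sum_inj (I J : finType) (h : I -> J) (F : J -> int) :
  injective h -> (forall j, 0 <= F j) -> \sum_i F (h i) <= \sum_j F j.
Proof.
move=> injh F_ge0; rewrite [leRHS](bigID (mem (h @: I))) /=.
rewrite big_imset /=; last by move=> x y _ _; apply: injh.
by rewrite lerDl sumr_ge0.
Qed.

(** Expanding the product of row sums gives one nonnegative term for every map from rows to columns.
    The Leibniz formula, in absolute value, keeps only the terms of permutations. *)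
Lemma det_norm_le (n : nat) (A : 'M[int]_n) : `|\det A| <= \prod_i \sum_j `|A i j|.
Proof.
rewrite bigA_distr_bigA /= /determinant.
apply: le_trans (ler_norm_sum _ _ _) _.
have -> : \sum_(s : 'S_n) `|(-1) ^+ s * \prod_i A i (s i)|
   = \sum_(s : 'S_n) \prod_i `|A i (pval s i)|.
  apply: eq_bigr => s _; rewrite normrM normrX normrN1 expr1n mul1r normr_prod.
  by apply: eq_bigr => i _; rewrite pvalE.
apply: (ler_sum_inj (F := fun f : {ffun 'I_n -> 'I_n} => \prod_i `|A i (f i)|)).
  exact: val_inj.
by move=> f; apply: prodr_ge0.
Qed.

(* Border a nonzero minor of maximal order r by a further row w0 and any column x:
   the new minor vanishes, and the coefficients of its expansion along x do not
   depend on x and are minors of order r. *)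
Lemma small_dependency (W X : finType) (A : W -> X -> nat) (H : {set W}) (b : nat) :
  (0 < b)%N -> (forall w, w \in H -> (\sum_x A w x <= b)%N) ->
  (exists beta : W -> int,
      [/\ exists2 w, w \in H & beta w != 0,
          forall w, `|beta w| <= (b ^ #|X|)%:Z &
          forall x, \sum_(w in H) beta w * (A w x)%:Z = 0]) \/
  (forall lam : W -> rat,
      (forall x, \sum_(w in H) lam w * (A w x)%:R = 0) ->
      forall w, w \in H -> lam w = 0).
Proof.
move=> b_gt0 Ab.
pose M r (f : 'I_r -> W) (g : 'I_r -> X) : 'M[int]_r := \matrix_(i, j) (A (f i) (g j))%:Z.
pose P r := [exists f : {ffun 'I_r -> W}, exists g : {ffun 'I_r -> X},
               [forall i, f i \in H] && (\det (M r f g) != 0)].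
(* [P] allows repeated rows and columns, but a repetition makes the determinant vanish, so a nonzero
   minor has distinct ones. *)
have injf r f g : \det (M r f g) != 0 -> injective f.
  move=> d0 i j eq_f; apply/eqP; apply: contraNT d0 => neq_ij.
  by rewrite (determinant_alternate neq_ij) // => l; rewrite !mxE eq_f.
have injg r f g : \det (M r f g) != 0 -> injective g.
  move=> d0 i j eq_g; apply/eqP; apply: contraNT d0 => neq_ij.
  by rewrite -det_tr (determinant_alternate neq_ij) // => l; rewrite !mxE eq_g.
have P0 : exists r, P r.
  (* The empty minor equals 1, so a maximal order exists even when [H] is empty or all entries
     vanish. *)
  exists 0%N; apply/existsP.
  have f0 (Z : Type) : 'I_0 -> Z by case.
  exists (finfun (f0 W)); apply/existsP; exists (finfun (f0 X)).
  by rewrite det_mx00 oner_neq0 andbT; apply/forallP => - [].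
have PX r : P r -> (r <= #|X|)%N.
  case/existsP => f /existsP[g] /andP[_ /injg/leq_card].
  by rewrite card_ord.
case: (ex_maxnP P0 PX) => r /existsP[f /existsP[g /andP[/forallP fH d0]]] maxr.
have rX : (r <= #|X|)%N.
  by have := leq_card _ (injg _ _ _ d0); rewrite card_ord.
(* Either some row of [H] lies outside the maximal minor and yields a dependency, or the minor uses
   all rows of [H] and these are independent. *)
have [/subsetP Hf|] := boolP (H \subset f @: 'I_r); last first.
  case/subsetPn => w0 w0H w0f; left.
  pose f' (i : 'I_r.+1) := oapp f w0 (unlift ord0 i).
  have f'H i : f' i \in H by rewrite /f'; case: unliftP => [j _|_] /=; [exact: fH|].
  have injf' : injective f'.
    move=> i j; rewrite /f'.
    case: unliftP => [i' ->|->]; case: unliftP => [j' ->|->] //= e.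
    - by rewrite (injf _ _ _ d0 _ _ e).
    - by case/negP: w0f; rewrite -e imset_f.
    - by case/negP: w0f; rewrite e imset_f.
  pose co (i : 'I_r.+1) : int :=
    (-1) ^+ i * \det (row' i (\matrix_(i < r.+1, j < r) (A (f' i) (g j))%:Z)).
  (* As [f'] is injective, the sum has at most one term: it transports the coefficients from row
     indices to [W], with 0 elsewhere. *)
  exists (fun w => \sum_(i | f' i == w) co i); split.
  - exists w0 => //; rewrite (bigD1 ord0) /=; last by rewrite /f' unlift_none.
    rewrite big1 ?addr0 => [|i /andP[/eqP e]]; last first.
      by case/eqP; apply: injf'; rewrite e /f' unlift_none.
    rewrite /co expr0 mul1r; congr (\det _ != 0): d0.
    by apply/matrixP => i j; rewrite !mxE /f' liftK.
  - move=> w; have [i /eqP fi|no] := pickP (fun i => f' i == w); last first.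
      by rewrite big1 ?normr0 // => i; rewrite no.
    rewrite (bigD1 i) ?fi //= big1 ?addr0 => [|j /andP[/eqP e]]; last first.
      by case/eqP; apply: injf'; rewrite e.
    rewrite /co normrM normrX normrN1 expr1n mul1r.
    apply: le_trans (det_norm_le _) _.
    (* Distinct columns make each row of the minor a part of a row of [A], of sum at most [b]. Then
       [r <= #|X|] and [0 < b] bring the exponent up to [#|X|]. *)
    apply: (@le_trans _ _ (\prod_(l < r) b%:Z)).
      apply: ler_prod => l _; rewrite sumr_ge0 //=.
      have := Ab _ (f'H (lift i l)).
      rewrite -lez_nat; apply: le_trans.
      rewrite (eq_bigr (fun j => (A (f' (lift i l)) (g j))%:Z)); last first.
        by move=> j _; rewrite !mxE.
      rewrite (big_morph _ PoszD (erefl _)).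
      exact: (ler_sum_inj (injg _ _ _ d0) (F := fun x => (A (f' (lift i l)) x)%:Z)).
    rewrite prodr_const card_ord -!natz -natrX ler_nat.
    by rewrite leq_pexp2l.
  - move=> x.
    pose g' (i : 'I_r.+1) := oapp g x (unlift ord0 i).
    (* Maximality of [r] also covers the case where [x] is already a column of the minor, since [P]
       does not ask for distinct columns. *)
    have : \det (M r.+1 f' g') = 0.
      apply/eqP; apply: contraT => dn0.
      suff /maxr : P r.+1 by rewrite ltnn.
      apply/existsP; exists (finfun f'); apply/existsP; exists (finfun g').
      apply/andP; split; first by apply/forallP => i; rewrite ffunE.
      by congr (\det _ != 0): dn0; apply/matrixP => i j; rewrite !mxE !ffunE.
    rewrite (expand_det_col _ ord0) => det0; rewrite -[RHS]det0 /=.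
    under eq_bigr => w _ do rewrite mulr_suml.
    rewrite (exchange_big_dep xpredT) //=.
    apply: eq_bigr => i _; rewrite (big_pred1 (f' i)) => [|w]; last first.
      by rewrite /= [RHS]eq_sym andb_idl // => /eqP <-.
    rewrite mxE /g' unlift_none /= mulrC; congr (_ * _).
    rewrite /cofactor addn0 /co; congr (_ * \det _).
    by apply/matrixP => j l; rewrite !mxE liftK.
right=> lam lam0 w wH.
pose L : 'rV[rat]_r := \row_i lam (f i).
pose B : 'M[rat]_r := map_mx intr (M r f g).
have uB : B \in unitmx.
  by rewrite unitmxE unitfE det_map_mx intr_eq0.
have LB : L *m B = 0.
  apply/rowP => j; rewrite !mxE -[RHS](lam0 (g j)).
  have -> : H = f @: 'I_r.
    apply/eqP; rewrite eqEsubset; apply/andP; split; apply/subsetP => z; first by move/Hf.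
    by case/imsetP => i _ ->.
  rewrite big_imset /=; last by move=> u v _ _; apply: (injf _ _ _ d0).
  by apply: eq_bigr => i _; rewrite !mxE.
have L0 : L = 0 by rewrite -[L](mulmxK uB) LB mul0mx.
have /imsetP[i _ ->] := Hf _ wH.
by move/rowP: L0 => /(_ i); rewrite !mxE.
Qed.

End SmallDependency.

(** Moving [g] along a dependency [e] changes the sum of squares by twice the scalar product of [g]
    and [e] plus the squared length of [e]. With the right sign of [e] this is a strict increase,
    and a fixed total bounds the sum of squares, so the process stops. *)
Lemma conic_reduction (W X : finType) (A : W -> X -> nat) (H : {set W}) (b : nat)
    (g : W -> nat) :
  0 < b -> (forall w, w \in H -> 0 < \sum_x A w x <= b) ->
  exists g' : W -> nat,
    (forall x, \sum_(w in H) g' w * A w x = \sum_(w in H) g w * A w x) /\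
    forall lam : W -> rat,
      (forall x, \sum_(w in H | (b ^ #|X| <= g' w)%N) lam w * (A w x)%:R = 0)%R ->
      forall w, w \in H -> b ^ #|X| <= g' w -> lam w = 0%R.
Proof.
move=> b_gt0 Ab; set M := b ^ #|X|.
pose R := \sum_x \sum_(w in H) g w * A w x.
pose q (h : W -> nat) := \sum_(w in H) h w ^ 2.
(* Every vector of [H] has a positive coordinate, so each multiplicity is at most the size [R] of
   the fixed total. *)
have q_le h : (forall x, \sum_(w in H) h w * A w x = \sum_(w in H) g w * A w x) ->
    q h <= #|H| * R ^ 2.
  move=> hg; rewrite -sum_nat_const; apply: leq_sum => w wH; rewrite leq_sqr.
  have /andP[A_gt0 _] := Ab _ wH.
  apply: leq_trans (leq_pmulr _ A_gt0) _; rewrite big_distrr /=.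
  by apply: leq_sum => x _; rewrite -hg (bigD1 w) //= leq_addr.
(* Induction on the gap between the sum of squares and its upper bound. *)
suff: forall n h, (forall x, \sum_(w in H) h w * A w x = \sum_(w in H) g w * A w x) ->
  #|H| * R ^ 2 - q h < n -> exists g' : W -> nat,
    (forall x, \sum_(w in H) g' w * A w x = \sum_(w in H) g w * A w x) /\
    forall lam : W -> rat,
      (forall x, \sum_(w in H | (M <= g' w)%N) lam w * (A w x)%:R = 0)%R ->
      forall w, w \in H -> M <= g' w -> lam w = 0%R.
  by move=> /(_ (#|H| * R ^ 2 - q g).+1 g); apply.
elim=> [//|n IHn] h hg lt_n.
pose H' := [set w in H | M <= h w].
have Ab' w : w \in H' -> \sum_x A w x <= b by rewrite inE => /andP[/Ab/andP[]].
have [[beta [[w0 w0H' beta0] beta_le beta_dep]]|indep] := small_dependency b_gt0 Ab'; last first.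
  exists h; split => // lam lam0 w wH hw; apply: indep; last by rewrite inE wH.
  by move=> x; rewrite -[RHS](lam0 x); apply: eq_bigl => v; rewrite inE.
have w0H : w0 \in H by move: w0H'; rewrite inE => /andP[].
(* [e] is [beta] or its opposite, extended by 0 off [H']. On [H'] the coefficients are at most [M],
   hence at most [h], so adding [e] keeps the multiplicities nonnegative. *)
have [e [e_le e_dep e_pos e0]] : exists e : W -> int,
    [/\ forall w, (`|e w| <= (h w)%:Z)%R,
        forall x, (\sum_(w in H) e w * (A w x)%:Z = 0)%R,
        (0 <= \sum_(w in H) (h w)%:Z * e w)%R & e w0 != 0%R].
  pose e w : int := if w \in H' then beta w else 0%R.
  have e_le w : (`|e w| <= (h w)%:Z)%R.
    rewrite /e inE; have [/andP[_ Mh]|_] := boolP (_ && _); last by rewrite normr0.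
    by apply: le_trans (beta_le w) _.
  have e_dep x : (\sum_(w in H) e w * (A w x)%:Z = 0)%R.
    rewrite -[RHS](beta_dep x) [RHS](eq_bigl (fun w => (w \in H) && (M <= h w)%N)); last first.
      by move=> w; rewrite inE.
    rewrite [RHS]big_mkcondr; apply: eq_bigr => w wH.
    by rewrite /e inE wH /=; case: ifP; rewrite ?mul0r.
  have e0 : e w0 != 0%R by rewrite /e w0H'.
  have [pos|neg] := lerP 0%R (\sum_(w in H) (h w)%:Z * e w)%R; first by exists e.
  exists (fun w => - e w)%R; split; rewrite ?oppr_eq0 //.
  - by move=> w; rewrite normrN.
  - by move=> x; under eq_bigr do rewrite mulNr; rewrite sumrN e_dep oppr0.
  - by under eq_bigr do rewrite mulrN; rewrite sumrN oppr_ge0 ltW.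
(* The bound [e_le] makes the sum nonnegative, so [absz] is a mere cast to [nat]. *)
pose h' w := absz ((h w)%:Z + e w)%R.
have h'E w : ((h' w)%:Z = (h w)%:Z + e w)%R.
  by rewrite /h'; have := e_le w; lia.
have h'g x : \sum_(w in H) h' w * A w x = \sum_(w in H) g w * A w x.
  rewrite -hg; apply/eqP; rewrite -eqz_nat !(big_morph _ PoszD (erefl _)).
  under eq_bigr do rewrite PoszM h'E mulrDl.
  rewrite big_split /= e_dep addr0; apply/eqP; apply: eq_bigr => w _.
  by rewrite PoszM.
apply: (IHn _ h'g).
suff: q h < q h' by have := q_le _ h'g; lia.
rewrite -ltz_nat /q !(big_morph _ PoszD (erefl _)).
have -> : (\sum_(w in H) (h' w ^ 2)%N%:Z =
  \sum_(w in H) (h w ^ 2)%N%:Z + (2 * \sum_(w in H) (h w)%:Z * e w + \sum_(w in H) e w * e w))%R.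
  rewrite mulr_sumr -!big_split /=; apply: eq_bigr => w _.
  by rewrite -!mulnn !PoszM h'E; ring.
rewrite ltrDl ltr_wpDl //; first by rewrite mulr_ge0.
rewrite (bigD1 w0) //= ltr_pwDl //; last by apply: sumr_ge0 => w _; rewrite -expr2 sqr_ge0.
by rewrite -expr2 exprn_even_gt0.
Qed.

(** * Circulations in a finite directed multigraph and their elementary cycles *)

Section Circulation.
Variables (V T : finType) (src tg : T -> V).
Implicit Types (B D E : {ffun T -> nat}) (s u : V).

Definition outflow B s := \sum_(t | src t == s) B t.
Definition inflow B s := \sum_(t | tg t == s) B t.
Definition circulation B := forall s, outflow B s = inflow B s.
Definition flow_step B : rel V :=
  fun s u => [exists t, [&& 0 < B t, src t == s & tg t == u]].
(** These are the indicators of simple directed cycles: with at most one edge leaving each vertex,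
    strong connectivity of the support leaves a single closed path. *)
Definition elementary E :=
  [/\ circulation E, exists t, 0 < E t, forall s, outflow E s <= 1 &
      forall s u, 0 < outflow E s -> 0 < outflow E u -> connect (flow_step E) s u].

Lemma outflow_gt0 B s : reflect (exists2 t, src t = s & 0 < B t) (0 < outflow B s).
Proof.
rewrite lt0n /outflow sum_nat_eq0 negb_forall_in.
apply: (iffP exists_inP) => [[t /eqP <-]|[t <-]] Bt; exists t => //; first by rewrite lt0n.
by rewrite -lt0n.
Qed.

Lemma inflow_gt0 B t : 0 < B t -> 0 < inflow B (tg t).
Proof. by move=> Bt; rewrite /inflow (bigD1 t) //= ltn_addr. Qed.

Lemma leq_outflow B t : B t <= outflow B (src t).
Proof. by rewrite /outflow (bigD1 t) //= leq_addr. Qed.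

Lemma sum_outflow B : \sum_s outflow B s = \sum_t B t.
Proof.
rewrite /outflow (exchange_big_dep xpredT) //=; apply: eq_bigr => t _.
by rewrite (big_pred1 (src t)) // => s; rewrite eq_sym.
Qed.

Lemma elementary_le1 E t : elementary E -> E t <= 1.
Proof. by case=> _ _ E1 _; apply: leq_trans (leq_outflow E t) (E1 _). Qed.

Lemma elementary_size E : elementary E -> \sum_t E t <= #|V|.
Proof.
case=> _ _ E1 _; rewrite -sum_outflow -sum1_card; exact: leq_sum.
Qed.

(* Choose a transition of B out of each state of its support; on a minimal nonempty
   set Y of states closed under the resulting successor map f, f is a cyclic
   permutation. *)
Lemma circulation_elementary B :
  circulation B -> (exists t, 0 < B t) ->
  exists2 E, elementary E & forall t, E t <= B t.
Proof.
move=> circB [t0 Bt0].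
(* The default [t0] only fills in states that [B] does not leave; [tau] matters on the support
   alone. *)
pose tau s := odflt t0 [pick t | (src t == s) && (0 < B t)].
have tauP s : 0 < outflow B s -> src (tau s) = s /\ 0 < B (tau s).
  case/outflow_gt0 => t <- Bt; rewrite /tau.
  by case: pickP => [t' /andP[/eqP]|/(_ t)] //=; rewrite eqxx Bt.
pose f s := tg (tau s).
have f_supp s : 0 < outflow B s -> 0 < outflow B (f s).
  by case/tauP => _ Bt; rewrite circB inflow_gt0.
pose P (Y : {set V}) := [&& Y != set0, [forall s in Y, 0 < outflow B s] & f @: Y \subset Y].
have [|Y /minsetP[/and3P[Y0 /forall_inP Ysupp fY] minY] _] :=
    @minset_exists _ P [set s | 0 < outflow B s].
  apply/and3P; split.
  - apply/set0Pn; exists (src t0); rewrite inE; apply/outflow_gt0; by exists t0.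
  - by apply/forall_inP => s; rewrite inE.
  - by apply/subsetP => u /imsetP[s]; rewrite !inE => /f_supp + ->.
have minY' (Z : {set V}) : Z \subset Y -> Z != set0 -> f @: Z \subset Z -> Z = Y.
  move=> ZY Z0 fZ; apply: minY => //; rewrite /P Z0 fZ andbT.
  by apply/forall_inP => s /(subsetP ZY)/Ysupp.
(* The image of [Y] is again nonempty and closed, so minimality makes [f] onto, hence injective, on
   the finite set [Y]. *)
have fYY : f @: Y = Y.
  apply: minY' => //; last exact: imsetS.
  by have [s sY] := set0Pn _ Y0; apply/set0Pn; exists (f s); rewrite imset_f.
have injf : {in Y &, injective f} by apply/imset_injP; rewrite fYY.
pose E : {ffun T -> nat} := [ffun t => ((src t \in Y) && (t == tau (src t))) : nat].
have Etau s : s \in Y -> E (tau s) = 1.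
  by move=> sY; have [st _] := tauP _ (Ysupp _ sY); rewrite ffunE st sY eqxx.
have sumE (Q : pred T) : \sum_(t | Q t) E t = \sum_(s in Y) (Q (tau s) : nat).
  rewrite big_mkcond (partition_big src predT) //= [RHS]big_mkcond.
  apply: eq_bigr => s _; have [sY|sY] := boolP (s \in Y).
    have [st _] := tauP _ (Ysupp _ sY).
    rewrite (bigD1 (tau s)) ?st //= Etau // big1 ?addn0; first by case: ifP.
    move=> t /andP[/eqP <- nt]; rewrite ffunE (negPf nt) andbF; by case: ifP.
  by rewrite big1 // => t /eqP st; rewrite ffunE st (negPf sY); case: ifP.
have outE s : outflow E s = (s \in Y).
  rewrite /outflow sumE.
  have -> : \sum_(u in Y) (src (tau u) == s : nat) = \sum_(u in Y) (u == s : nat).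
    by apply: eq_bigr => u uY; have [-> _] := tauP _ (Ysupp _ uY).
  have [sY|sY] := boolP (s \in Y).
    by rewrite (bigD1 s) //= eqxx big1 // => u /andP[_ /negPf->].
  by rewrite big1 // => u uY; apply/eqP; rewrite eqb0; apply: contraNneq sY => <-.
exists E; last first.
  move=> t; rewrite ffunE; case: andP => [[tY /eqP e]|] //.
  by have [_] := tauP _ (Ysupp _ tY); rewrite -e.
split.
- move=> s; rewrite outE /inflow sumE -/(f _).
  rewrite -(big_imset (fun u => (u == s : nat)) injf) fYY.
  have [sY|sY] := boolP (s \in Y).
    by rewrite (bigD1 s) //= eqxx big1 // => u /andP[_ /negPf->].
  by rewrite big1 // => u uY; apply/eqP; rewrite eqb0; apply: contraNneq sY => <-.
- by have [s sY] := set0Pn _ Y0; exists (tau s); rewrite Etau.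
- by move=> s; rewrite outE; case: (s \in Y).
- move=> s u; rewrite !outE !lt0b => sY uY.
  (* The states reachable from [s] form a nonempty closed subset of [Y], so by minimality they are
     all of [Y]. *)
  pose Z := [set v in Y | connect (flow_step E) s v].
  suff: Z = Y by move/setP/(_ u); rewrite !inE uY.
  apply: minY'.
  + by apply/subsetP => v; rewrite inE => /andP[].
  + by apply/set0Pn; exists s; rewrite inE sY connect0.
  + apply/subsetP => _ /imsetP[v + ->]; rewrite !inE => /andP[vY sv].
    rewrite -{1}fYY imset_f //=; apply: connect_trans sv (connect1 _).
    apply/existsP; exists (tau v); rewrite Etau //=.
    by have [-> _] := tauP _ (Ysupp _ vY); rewrite eqxx /f eqxx.
Qed.

(** Where [B] leaves a state, it must use the only transition of [E] there. So the support of [B] is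
    closed under the steps of [E], and strong connectivity spreads it over all of [E]. *)
Lemma elementary_minimal E B :
  elementary E -> circulation B -> (exists t, 0 < B t) ->
  (forall t, B t <= E t) -> B = E.
Proof.
move=> [circE _ E1 connE] circB [t0 Bt0] BE.
have suppBE s : 0 < outflow B s -> 0 < outflow E s.
  by case/outflow_gt0 => t <- Bt; apply/outflow_gt0; exists t => //; apply: leq_trans (BE t).
have BEeq s t : 0 < outflow B s -> src t = s -> B t = E t.
  move=> Bs st; apply/eqP; rewrite eqn_leq BE /= leqNgt; apply/negP => lt.
  have := E1 s; rewrite leqNgt => /negP; apply; apply: leq_ltn_trans Bs _.
  rewrite /outflow (bigD1 t) ?st //= [X in _ < X](bigD1 t) ?st //= -addSn.
  by apply: leq_add => //; apply: leq_sum.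
have closedB s u : connect (flow_step E) s u -> 0 < outflow B s -> 0 < outflow B u.
  case/connectP => p + ->; elim: p s => [//|v p IHp] s /= /andP[/existsP[t]].
  case/and3P => Et /eqP st /eqP tv pathp Bs; apply: IHp pathp _.
  by rewrite -tv circB inflow_gt0 // (BEeq _ _ Bs st).
apply/ffunP => t; have [Bt|] := boolP (0 < outflow B (src t)); first exact: BEeq Bt _.
move=> Bt; have [Et|] := posnP (E t); first by apply/eqP; rewrite eqn_leq BE Et.
move=> Et; case/negP: Bt; apply: (closedB (src t0)).
  apply: connE; last by apply/outflow_gt0; exists t.
  by apply: suppBE; apply/outflow_gt0; exists t0.
by apply/outflow_gt0; exists t0.
Qed.

Lemma circulation_decomposition B : circulation B ->
  exists2 es : seq {ffun T -> nat},
    {in es, forall E, elementary E} & forall t, B t = \sum_(E <- es) E t.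
Proof.
have [n] := ubnP (\sum_t B t); elim: n B => [//|n IHn] B lt_n circB.
have [/existsP Bn0|] := boolP [exists t, 0 < B t]; last first.
  rewrite negb_exists => /forallP B0; exists [::] => // t.
  by rewrite big_nil; apply/eqP; rewrite -leqn0 leqNgt B0.
have [E elE EB] := circulation_elementary circB Bn0.
pose B' : {ffun T -> nat} := [ffun t => B t - E t].
have BE (Q : pred T) : \sum_(t | Q t) B t = \sum_(t | Q t) B' t + \sum_(t | Q t) E t.
  by rewrite -big_split; apply: eq_bigr => t _; rewrite /= ffunE subnK.
have circE : circulation E by case: elE.
have [||es es_el esE] := IHn B'.
- move: lt_n; rewrite BE; case: elE => _ [t Et] _ _ lt_n.
  have : 0 < \sum_t E t by rewrite (bigD1 t) //= ltn_addr.
  by lia.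
- move=> s; have := circB s; rewrite /outflow /inflow !BE.
  by rewrite -/(outflow E s) circE -/(inflow E s) => /addIn.
exists (E :: es) => [F|t]; first by rewrite inE => /predU1P[->|/es_el].
by rewrite big_cons -esE ffunE addnC subnK.
Qed.

End Circulation.

(** * Reachability in a grammar, and attaching cycles to runs *)

Section Grammar.
Variables (Sigma : finType) (G : grammar Sigma).
Local Notation S := (state G).
Local Notation T := (trans G).
Implicit Types (C D E : {ffun T -> nat}) (s u : S) (t : T).

Definition step D : rel S :=
  fun s u => [exists t, [&& 0 < D t, src t == s & 0 < tgt t u]].

Lemma connected_fromP D s :
  connected_from D s <-> {in supp G D, forall u, connect (step D) s u}.
Proof.
split=> conn u uD; last first.
  have /connectP[p] := conn u uD.
  elim: p s {conn uD} => [|v p IHp] s /=; first by move=> _ ->; left.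
  case/andP => /existsP[t /and3P[Dt /eqP st tv]] pathp u_last; right.
  have [->|[t1 [q [Dt1 Dq st1 pathq lastq]]]] := IHp v pathp u_last.
    by exists t, [::].
  by exists t, (t1 :: q); split=> //=; rewrite ?Dt1 ?st1 ?tv.
have [->|[t [p [Dt Dp <- pathp lastp]]]] := conn u uD; first exact: connect0.
elim: p t Dt Dp pathp lastp => [|t' p IHp] t Dt /=.
  by move=> _ _ tu; apply: connect1; apply/existsP; exists t; rewrite Dt eqxx.
case/andP=> Dt' Dp /andP[tt' pathp] lastp.
apply: connect_trans (connect1 _) (IHp t' Dt' Dp pathp lastp).
by apply/existsP; exists t; rewrite Dt eqxx.
Qed.

Lemma step_mono C D : (forall t, C t <= D t) ->
  subrel (connect (step C)) (connect (step D)).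
Proof.
move=> CD; apply: connect_sub => s u /existsP[t /and3P[Ct st tu]]; apply: connect1.
by apply/existsP; exists t; rewrite st tu (leq_trans Ct).
Qed.

Lemma in_supp D s : (s \in supp G D) = (0 < outflow (@src _ G) D s).
Proof. by rewrite inE ffunE. Qed.

Lemma supp_mono C D : (forall t, C t <= D t) -> supp G C \subset supp G D.
Proof.
move=> CD; apply/subsetP => s; rewrite !in_supp => /outflow_gt0[t st Ct].
by apply/outflow_gt0; exists t => //; apply: leq_trans (CD t).
Qed.

(** A state of [C] is reached through [D] from [s0] to [s], then through [C]; a cycle has equal
    sources and targets, so the balance is unchanged. *)
Lemma is_run_add D C s : is_run G D -> cycle_from C s -> s \in supp G D ->
  is_run G [ffun t => D t + C t].
Proof.
move=> [connD balD] [connC balC] sD; set F := finfun _.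
have DF t : D t <= F t by rewrite ffunE leq_addr.
have CF t : C t <= F t by rewrite ffunE leq_addl.
have s0F u : u \in supp G D -> connect (step F) (s0 G) u.
  by move=> uD; apply: step_mono DF _ _ _; apply: (connected_fromP D _).1.
split.
  apply/connected_fromP => u; rewrite in_supp => /outflow_gt0[t tu].
  rewrite ffunE addn_gt0 => /orP[Dt|Ct].
    by apply: s0F; rewrite in_supp; apply/outflow_gt0; exists t.
  apply: connect_trans (s0F _ sD) _; apply: step_mono CF _ _ _.
  by apply: (connected_fromP C _).1 => //; rewrite in_supp; apply/outflow_gt0; exists t.
move=> u; have := balD u; move/ffunP/(_ u): balC; rewrite !ffunE => balC balD'.
under eq_bigr do rewrite ffunE.
under [X in _ = X + _]eq_bigr do rewrite ffunE mulnDl.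
by rewrite !big_split /= balD' balC; lia.
Qed.

Lemma is_run_add_sum D (I : eqType) (r : seq I) (C : I -> {ffun T -> nat}) (alpha : I -> nat) :
  is_run G D ->
  {in r, forall i, exists2 s, s \in supp G D & cycle_from (C i) s} ->
  is_run G [ffun t => D t + \sum_(i <- r) alpha i * C i t].
Proof.
move=> runD; elim: r => [|i r IHr] cycC.
  by congr is_run: runD; apply/ffunP => t; rewrite ffunE big_nil addn0.
have {}IHr := IHr (fun j jr => cycC j (mem_behead (s := i :: r) jr)).
have [s sD cyc] := cycC i (mem_head _ _).
have -> : [ffun t => D t + \sum_(j <- i :: r) alpha j * C j t] =
   [ffun t => [ffun t => D t + \sum_(j <- r) alpha j * C j t] t + alpha i * C i t].
  by apply/ffunP => t; rewrite !ffunE big_cons; lia.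
elim: (alpha i) => [|a IHa].
  by congr is_run: IHr; apply/ffunP => t; rewrite [in RHS]ffunE addn0.
have /(_ _) := is_run_add IHa cyc.
have sF : s \in supp G [ffun t => [ffun t => D t + \sum_(j <- r) alpha j * C j t] t + a * C i t].
  by apply: subsetP sD; apply: supp_mono => t; rewrite !ffunE -addnA leq_addr.
move=> /(_ sF) runF; congr is_run: runF; apply/ffunP => t; rewrite !ffunE; lia.
Qed.

(** * Runs and cycles of a regular grammar as circulations *)

Hypothesis regG : regular G.

Definition terminal t := size1 (tgt t) == 0.

(* Terminal transitions are redirected to [s0], so that runs become circulations. *)
Definition next t : S := odflt (s0 G) [pick u | 0 < tgt t u].

Definition terminations D := \sum_(t | terminal t) D t.

Local Notation circ := (circulation (@src _ G) next).
Local Notation elem := (elementary (@src _ G) next).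

Lemma next_terminal t : terminal t -> next t = s0 G.
Proof.
rewrite /terminal /size1 sum_nat_eq0 => /forallP t0; rewrite /next.
by case: pickP => //= u; rewrite (eqP (t0 u)).
Qed.

Lemma tgtE t s : tgt t s = ~~ terminal t && (next t == s) :> nat.
Proof.
have [ter|nter] /= := boolP (terminal t).
  by move: ter; rewrite /terminal /size1 sum_nat_eq0 => /forallP/(_ s)/eqP.
rewrite /next; case: pickP => [u u_gt0|no] /=; last first.
  by case/negP: nter; rewrite /terminal /size1 sum_nat_eq0; apply/forallP => u; rewrite -leqn0 leqNgt no.
have := regG t; rewrite /size1 (bigD1 u) //=.
case: (eqVneq u s) => [<-|us]; first by move: u_gt0; case: (tgt t u) => [|[]] //; lia.
by rewrite (bigD1 s) 1?eq_sym //=; move: u_gt0; lia.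
Qed.

Lemma inflowE D s :
  inflow next D s = targetD D s + (s == s0 G) * terminations D.
Proof.
rewrite ffunE /inflow (bigID terminal) /= addnC; congr (_ + _).
  rewrite big_mkcond; apply: eq_bigr => t _; rewrite tgtE andbC.
  by case: (_ && _); rewrite ?muln1 ?muln0.
rewrite /terminations; have [->|s_n0] := eqVneq s (s0 G).
  rewrite mul1n; apply: eq_bigl => t.
  by rewrite andb_idl // => /next_terminal->.
rewrite big_pred0 // => t; apply/negP => /andP[/eqP ts ter].
by rewrite -ts next_terminal // eqxx in s_n0.
Qed.

(** Every transition has exactly one target unless it is terminal, so the targets fall short of the
    transitions by the terminations. Compared with the sources, this leaves no termination in a
    balanced vector and exactly one in a run. *)
Lemma sum_targetD D : \sum_s targetD D s + terminations D = \sum_t D t.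
Proof.
rewrite -[RHS](sum_outflow next) (eq_bigr _ (fun s _ => inflowE D s)) big_split /=.
congr (_ + _); rewrite (bigD1 (s0 G)) //= eqxx mul1n big1 ?addn0 // => s /negPf-> //.
Qed.

Lemma sum_sourceD D : \sum_s sourceD D s = \sum_t D t.
Proof. by rewrite -(sum_outflow (@src _ G)); apply: eq_bigr => s _; rewrite ffunE. Qed.

Lemma balanced_circulation D : sourceD D = targetD D <-> circ D /\ terminations D = 0.
Proof.
split=> [bal|[circD ter0]]; last first.
  by apply/ffunP => s; have := circD s; rewrite inflowE ter0 muln0 addn0 [sourceD D s]ffunE.
suff ter0: terminations D = 0.
  by split=> // s; rewrite inflowE ter0 muln0 addn0 -bal ffunE.
by have := sum_targetD D; rewrite -(sum_sourceD D) bal; lia.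
Qed.

Lemma run_circulation D :
  (forall s, sourceD D s = targetD D s + (s == s0 G)) <-> circ D /\ terminations D = 1.
Proof.
split=> [bal|[circD ter1] s]; last first.
  by have := circD s; rewrite inflowE ter1 muln1 [sourceD D s]ffunE.
suff ter1: terminations D = 1.
  by split=> // s; rewrite inflowE ter1 muln1 -bal ffunE.
have := sum_targetD D; rewrite -(sum_sourceD D) (eq_bigr _ (fun s _ => bal s)) big_split /=.
have -> : \sum_s (s == s0 G) = 1 by rewrite (bigD1 (s0 G)) //= eqxx big1 // => s /negPf->.
by move/addnI.
Qed.

Lemma step_flow D : subrel (step D) (flow_step (@src _ G) next D).
Proof.
move=> s u /existsP[t /and3P[Dt st]]; rewrite tgtE lt0b => /andP[_ tu].
by apply/existsP; exists t; rewrite Dt st.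
Qed.

Lemma flow_stepE D s u : flow_step (@src _ G) next D s u -> step D s u \/ u = s0 G.
Proof.
case/existsP => t /and3P[Dt st tu].
have [/next_terminal next_t|nter] := boolP (terminal t).
  by right; rewrite -next_t (eqP tu).
by left; apply/existsP; exists t; rewrite Dt st tgtE nter tu.
Qed.

Lemma connect_flow_s0 D u :
  connect (flow_step (@src _ G) next D) (s0 G) u -> connect (step D) (s0 G) u.
Proof.
case/connectP => p + ->; elim/last_ind: p => [|p v IHp] //.
rewrite rcons_path last_rcons => /andP[/IHp conn /flow_stepE[st|->]] //.
exact: connect_trans conn (connect1 st).
Qed.

Lemma terminations_gt0 D : 0 < terminations D -> exists2 t, terminal t & 0 < D t.
Proof.
rewrite lt0n /terminations sum_nat_eq0 negb_forall_in => /exists_inP[t tt].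
by rewrite -lt0n; exists t.
Qed.

(** The redirected terminal transition enters [s0], which puts [s0] on the cycle; all its states are
    then reachable from there. *)
Lemma elementary_is_run E : elem E -> terminations E = 1 -> is_run G E.
Proof.
move=> [circE _ _ connE] ter1; split; last exact/run_circulation.
apply/connected_fromP => u; rewrite in_supp => uE.
apply: connect_flow_s0; apply: connE uE.
have [|t tt Et] := @terminations_gt0 E; first by rewrite ter1.
by rewrite -(next_terminal tt) circE inflow_gt0.
Qed.

Lemma elementary_cycle_from E s :
  elem E -> terminations E = 0 -> s \in supp G E -> cycle_from E s.
Proof.
move=> [circE _ _ connE] ter0; rewrite in_supp => sE.
split; last exact/balanced_circulation.
apply/connected_fromP => u; rewrite in_supp => uE.
apply: (connect_sub _ (connE _ _ sE uE)) => a b /existsP[t /and3P[Et sa tb]].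
apply: connect1; apply/existsP; exists t; rewrite Et sa tgtE tb andbT lt0b /=.
apply/negP => tt; have : 0 < terminations E by rewrite /terminations (bigD1 t) //= ltn_addr.
by rewrite ter0.
Qed.

(** A nonzero cycle below [E] is [E] itself by minimality, so only the empty sum could have all its
    summands smaller, and that sum is zero. *)
Lemma elementary_simple_cycle E : elem E -> terminations E = 0 -> simple_cycle E.
Proof.
move=> elE ter0; have [circE [t Et] _ _] := elE; split.
- by move=> E0; rewrite E0 ffunE in Et.
- exists (src t); apply: elementary_cycle_from => //.
  by rewrite in_supp; apply/outflow_gt0; exists t.
- case=> [[|C cs] [csP Esum]]; first by move: Et; rewrite Esum big_nil.
  have [C0 [s [_ balC]] [CE CneE]] := csP C (mem_head _ _).
  apply: CneE; apply: (elementary_minimal elE) => //; first by case/balanced_circulation: balC.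
  apply/existsP; apply: contra_notT C0; rewrite negb_exists => /forallP C0.
  by apply/ffunP => t'; rewrite ffunE; apply/eqP; rewrite -leqn0 leqNgt C0.
Qed.

Lemma elementary_simple_cycle_in (A : {set S}) E :
  elem E -> terminations E = 0 -> supp G E \subset A -> simple_cycle_in G A E.
Proof.
move=> elE ter0 EA; split; first exact: elementary_simple_cycle.
have [_ [t Et] _ _] := elE.
have tE : src t \in supp G E by rewrite in_supp; apply/outflow_gt0; exists t.
by exists (src t); [exact: subsetP EA _ tE | exact: elementary_cycle_from].
Qed.

(** Terminations add up over the elementary summands and total 1, so exactly one summand
    terminates. *)
Lemma run_decomposition D : is_run G D ->
  exists P (es : seq {ffun T -> nat}),
    [/\ elem P, terminations P = 1,
        {in es, forall E, elem E /\ terminations E = 0} &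
        forall t, D t = P t + \sum_(E <- es) E t].
Proof.
case=> _ /run_circulation[circD ter1].
have [es es_el esD] := circulation_decomposition circD.
have : \sum_(E <- es) terminations E = 1.
  rewrite -[RHS]ter1 /terminations exchange_big /=; apply: eq_bigr => t _; exact/esym/esD.
move=> sum1.
have /hasP[P Pes Pgt0] : has (fun E => 0 < terminations E) es.
  apply: contra_eqT sum1 => /hasPn no; rewrite big_seq big1 // => E /no.
  by rewrite lt0n negbK => /eqP.
have perm := perm_to_rem Pes.
have {}esD t : D t = P t + \sum_(E <- rem P es) E t.
  by rewrite esD (perm_big _ perm) big_cons.
move: sum1; rewrite (perm_big _ perm) big_cons /= => sum1.
exists P, (rem P es); split=> //; [exact: es_el|by move: Pgt0 => /=; lia|].
move=> E Erem; split; first by apply: es_el; apply: mem_rem Erem.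
by move: sum1; rewrite (big_rem E) //=; lia.
Qed.

(* Cycles are attached one at a time, each reaching a state not covered so far,
   so that the result stays connected and at most [#|S|] of them are needed. *)
Lemma run_skeleton D : is_run G D ->
  exists D0 (es : seq {ffun T -> nat}),
    [/\ is_run G D0, forall t, D0 t <= #|S|,
        {in es, forall E, [/\ elem E, terminations E = 0 & supp G E \subset supp G D0]} &
        forall t, D t = D0 t + \sum_(E <- es) E t].
Proof.
move=> runD; have [P [es [elP terP esP esD]]] := run_decomposition runD.
have runP := elementary_is_run elP terP.
(* The invariant bounds the entries by the size of the support: an attached cycle raises each entry
   by at most 1 and adds at least one state. *)
suff: forall n D0 (es : seq {ffun T -> nat}), size es = n -> is_run G D0 ->
   (forall t, D0 t <= #|supp G D0|) ->
   {in es, forall E, elem E /\ terminations E = 0} ->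
   (forall t, D t = D0 t + \sum_(E <- es) E t) ->
   exists D0 (es : seq {ffun T -> nat}),
    [/\ is_run G D0, forall t, D0 t <= #|S|,
        {in es, forall E, [/\ elem E, terminations E = 0 & supp G E \subset supp G D0]} &
        forall t, D t = D0 t + \sum_(E <- es) E t].
  apply; [reflexivity|exact: runP| |exact: esP|exact: esD].
  move=> t; have := elementary_le1 t elP; case: (posnP (P t)) => [-> //|Pt] P1.
  apply: leq_trans P1 _; rewrite card_gt0; apply/set0Pn; exists (src t).
  by rewrite in_supp; apply/outflow_gt0; exists t.
elim=> [|n IHn] D0 {P elP terP esP esD runP} {}es size_es runD0 D0le esP esD.
  exists D0, es; split=> //; first by move=> t; apply: leq_trans (D0le t) (max_card _).
  by case: es size_es {esP esD}.
have [DD0|/subsetPn[u uD uD0]] := boolP (supp G D \subset supp G D0).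
  exists D0, es; split=> //; first by move=> t; apply: leq_trans (D0le t) (max_card _).
  move=> E Ees; have [elE terE] := esP _ Ees; split=> //; apply: subset_trans DD0.
  by apply: supp_mono => t; rewrite esD (big_rem E) //= addnCA leq_addr.
have [circD0 ter1] := (run_circulation D0).1 runD0.2.
have s0D0 : s0 G \in supp G D0.
  have [|t tt Et] := @terminations_gt0 D0; first by rewrite ter1.
  by rewrite in_supp -(next_terminal tt) circD0 inflow_gt0.
have [t tD0 [Dt tnD0]] : exists2 t, src t \in supp G D0 & 0 < D t /\ next t \notin supp G D0.
  have /connectP[p] := (connected_fromP _ _).1 runD.1 u uD.
  elim: p (s0 G) s0D0 => [|v p IHp] s sD0 /=; first by move=> _ us; rewrite us sD0 in uD0.
  case/andP => sv pathp u_last.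
  have [vD0|vD0] := boolP (v \in supp G D0); first exact: IHp pathp u_last.
  have /existsP[t /and3P[Dt /eqP st /eqP tv]] := step_flow sv.
  by exists t; rewrite ?st ?tv.
(* By conservation, [D0] would otherwise also cover [next t]. So [t] comes from a remaining cycle,
   which meets the support at [src t] and can be attached there. *)
have D0t : D0 t = 0.
  apply/eqP; apply: contraNT tnD0; rewrite -lt0n => D0t.
  by rewrite in_supp circD0 inflow_gt0.
have /hasP[E Ees Et] : has (fun E : {ffun T -> nat} => 0 < E t) es.
  apply: contraLR Dt => /hasPn no; rewrite esD D0t add0n -leqNgt big_seq big1 // => E /no.
  by rewrite lt0n negbK => /eqP.
have [elE terE] := esP _ Ees; have perm := perm_to_rem Ees.
apply: (IHn [ffun t => D0 t + E t] (rem E es)).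
- by rewrite size_rem // size_es.
- apply: (is_run_add (s := src t)) => //; apply: elementary_cycle_from => //.
  by rewrite in_supp; apply/outflow_gt0; exists t.
- move=> t'; rewrite ffunE; set F := finfun _.
  have : supp G D0 \proper supp G F.
    apply/properP; split; first by apply: supp_mono => t2; rewrite ffunE leq_addr.
    exists (next t) => //; apply: (subsetP (_ : supp G E \subset _)).
      by apply: supp_mono => t2; rewrite ffunE leq_addl.
    by rewrite in_supp; case: elE => -> _ _ _; rewrite inflow_gt0.
  move/proper_card; apply: leq_trans; rewrite -addn1.
  by rewrite leq_add // (elementary_le1 _ elE).
- by move=> F /mem_rem/esP.
- by move=> t'; rewrite esD (perm_big _ perm) big_cons ffunE addnA.
Qed.

Lemma outD_elementary_le E : (forall t, size1 (outt t) <= 1) -> elem E ->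
  \sum_a outD G E a <= #|S|.
Proof.
move=> out1 elE; apply: leq_trans (elementary_size elE).
under eq_bigr do rewrite ffunE; rewrite exchange_big /=; apply: leq_sum => t _.
by rewrite -big_distrr /= -[leqRHS]muln1 leq_mul2l out1 orbT.
Qed.

End Grammar.

(** * Outputs, the numerical bound, and the reduction of a run *)

Lemma outD_add_sum (Sigma : finType) (G : grammar Sigma) (D : {ffun trans G -> nat})
    (I : Type) (r : seq I) (C : I -> {ffun trans G -> nat}) (alpha : I -> nat) a :
  outD G [ffun t => D t + \sum_(i <- r) alpha i * C i t] a =
  outD G D a + \sum_(i <- r) alpha i * outD G (C i) a.
Proof.
rewrite !ffunE; under eq_bigr do rewrite ffunE mulnDl big_distrl /=.
rewrite big_split exchange_big /=; congr (_ + _); apply: eq_bigr => i _.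
by rewrite ffunE big_distrr /=; apply: eq_bigr => t _; rewrite mulnA.
Qed.

Lemma leq_exp2_fact k : 2 ^ k <= 2 * k`!.
Proof.
elim: k => [|[|k] IHk] //; rewrite expnS factS.
by rewrite [leqRHS]mulnCA leq_mul.
Qed.

(** From [n.+1 <= 2 * n] comes a factor [2 ^ k], which the factorial absorbs up to a factor 2; the
    summand [n] accounts for the third unit. For [k = 0] the right side is the constant 3 and the
    bound fails for large [n]. *)
Lemma norm_bound n k : 0 < n -> 0 < k ->
  n + n.+1 ^ k * n ^ k <= 3 * n ^ (2 * k) * k`!.
Proof.
move=> n_gt0 k_gt0.
have n_le : n <= n ^ (2 * k) * k`!.
  apply: leq_trans (leq_pmulr _ (fact_gt0 k)).
  by rewrite -[leqLHS]expn1 leq_pexp2l //; lia.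
have le2 : n.+1 ^ k * n ^ k <= 2 * (n ^ (2 * k) * k`!).
  have -> : 2 * (n ^ (2 * k) * k`!) = 2 * k`! * n ^ k * n ^ k by rewrite (mul2n k) -addnn expnD; lia.
  rewrite leq_mul2r; apply/orP; right.
  apply: (@leq_trans (2 ^ k * n ^ k)); first by rewrite -expnMn leq_exp2r //; lia.
  by rewrite leq_mul2r leq_exp2_fact orbT.
by rewrite -mulnA; lia.
Qed.

(** Only the total output must survive, so one cycle may stand for all those with the same output
    vector. There are at most [n.+1 ^ #|Sigma|] such vectors, and the representatives merged into
    the run have multiplicity below [n ^ #|Sigma|]. *)
Lemma reduced_run (Sigma : finType) (G : grammar Sigma) (D : {ffun trans G -> nat}) :
  regular G -> (forall t, size1 (@outt _ G t) <= 1) -> is_run G D ->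
  exists D' : {ffun trans G -> nat},
    [/\ is_run G D',
        forall t, D' t <= #|state G| + #|state G|.+1 ^ #|Sigma| * #|state G| ^ #|Sigma| &
        exists (m : nat) (C : 'I_m -> {ffun trans G -> nat}),
          [/\ forall i, simple_cycle_in G (supp G D') (C i),
              lin_indep G C &
              exists alpha : 'I_m -> nat,
                forall a, outD G D a = outD G D' a + \sum_i alpha i * outD G (C i) a]].
Proof.
move=> regG out1 runD; set n := #|state G|.
have n_gt0 : 0 < n by apply/card_gt0P; exists (s0 G).
have [D0 [es [runD0 D0le esP esD]]] := run_skeleton regG runD.
(* Recording outputs in ['I_n.+1] makes the vectors a finite type; [inord] loses nothing on the
   cycles of [es], whose outputs are at most [n]. *)
pose wt (E : {ffun trans G -> nat}) : {ffun Sigma -> 'I_n.+1} := [ffun a => inord (outD G E a)].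
have out_le E : E \in es -> \sum_a outD G E a <= n.
  by case/esP => elE _ _; apply: outD_elementary_le elE.
have wtE E a : E \in es -> wt E a = outD G E a :> nat.
  move=> /out_le Ele; rewrite ffunE inordK // ltnS; apply: leq_trans Ele.
  by rewrite (bigD1 a) //= leq_addr.
pose A (w : {ffun Sigma -> 'I_n.+1}) a : nat := w a.
(* Cycles without output are discarded: they do not affect the total, and the reduction needs
   vectors of positive size. *)
pose H := [set w in map wt es | 0 < \sum_a A w a].
have Ab w : w \in H -> 0 < \sum_a A w a <= n.
  rewrite inE => /andP[/mapP[E Ees ->] ->] /=.
  by rewrite (eq_bigr _ (fun a _ => wtE E a Ees)) out_le.
pose g w := count (fun E => wt E == w) es.
have outDE a : outD G D a = outD G D0 a + \sum_(w in H) g w * A w a.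
  have -> : D = [ffun t => D0 t + \sum_(E <- es) 1 * E t].
    by apply/ffunP => t; rewrite ffunE esD; congr (_ + _); apply: eq_bigr => E _; rewrite mul1n.
  rewrite outD_add_sum; congr (_ + _).
  rewrite (partition_big wt xpredT) //= [RHS]big_mkcond /=; apply: eq_bigr => w _.
  transitivity (g w * A w a).
    rewrite /g -sum1_count big_distrl /= big_seq_cond [RHS]big_seq_cond.
    by apply: eq_bigr => E /andP[Ees /eqP <-]; rewrite /A wtE.
  case: ifP => // /negbT; rewrite inE negb_and => /orP[wn|].
    suff -> : g w = 0 by [].
    apply/eqP; rewrite -leqn0 leqNgt -has_count; apply: contra wn => /hasP[E Ees /eqP <-].
    exact: map_f.
  by rewrite lt0n negbK sum_nat_eq0 => /forallP/(_ a)/eqP->; rewrite muln0.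
have [g' [g'E indep]] := conic_reduction g n_gt0 Ab.
pose M := n ^ #|Sigma|.
pose rep w := nth [ffun => 0] es (index w (map wt es)).
have repP w : w \in H -> rep w \in es /\ wt (rep w) = w.
  rewrite inE => /andP[wes _]; have : index w (map wt es) < size es.
    by rewrite -(size_map wt) index_mem.
  move=> lt; split; first exact: mem_nth.
  by rewrite -(nth_map _ (wt [ffun => 0])) // nth_index.
pose L := [set w in H | g' w < M]; pose U := [set w in H | M <= g' w].
have LE w : (w \in L) = (w \in H) && (g' w < M) by rewrite [LHS]in_set.
have UE w : (w \in U) = (w \in H) && (M <= g' w) by rewrite [LHS]in_set.
have LH w : w \in L -> w \in H by rewrite LE => /andP[].
have UH w : w \in U -> w \in H by rewrite UE => /andP[].
pose D' : {ffun trans G -> nat} := [ffun t => D0 t + \sum_(w <- enum L) g' w * rep w t].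
have DD' : supp G D0 \subset supp G D' by apply: supp_mono => t; rewrite ffunE leq_addr.
have rep_le1 w t : w \in H -> rep w t <= 1.
  by move=> /repP[/esP[elE _ _] _]; apply: elementary_le1 elE.
exists D'; split.
- apply: is_run_add_sum runD0 _ => w; rewrite mem_enum => /LH/repP[/esP[elE terE sE] _].
  have [_ [s sA cyc]] := elementary_simple_cycle_in regG elE terE sE.
  by exists s.
- move=> t; rewrite ffunE leq_add // big_enum /=.
  apply: (@leq_trans (\sum_(w in L) M)).
    apply: leq_sum => w wL; rewrite -[leqRHS]muln1 leq_mul ?rep_le1 ?LH //.
    by move: wL; rewrite LE => /andP[_ /ltnW].
  rewrite sum_nat_const leq_mul2r; apply/orP; right.
  by apply: leq_trans (max_card _) _; rewrite card_ffun card_ord.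
exists #|U|, (fun i => rep (enum_val i)).
have outrep w a : w \in H -> outD G (rep w) a = A w a.
  by case/repP => wes wE; rewrite -wtE // wE.
split.
- move=> i; have /UH/repP[/esP[elE terE sE] _] := enum_valP i.
  by apply: elementary_simple_cycle_in => //; apply: subset_trans sE DD'.
- move=> lam lam0 i; have w0U := enum_valP i.
  (* Output is linear, so a dependency among the cycles is one among their output vectors, which are
     independent. [lamW] carries the coefficients over to vectors; its values off [U] do not
     matter. *)
  pose lamW w := lam (enum_rank_in w0U w).
  have lamWE j : lamW (enum_val j) = lam j by rewrite /lamW enum_valK_in.
  rewrite -lamWE; apply: indep; [|exact: UH|by move: (w0U); rewrite UE => /andP[]].
  move=> a; transitivity (\sum_(w in U) lamW w * (outD G (rep w) a)%:R : rat)%R.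
    rewrite big_mkcond [RHS]big_mkcond; apply: eq_bigr => w _; rewrite UE.
    by case: ifP => // /andP[wH _]; rewrite outrep.
  rewrite big_enum_val /=.
  transitivity (\sum_t (\sum_j lam j * (rep (enum_val j) t)%:R) * (outt t a)%:R : rat)%R; last first.
    by rewrite big1 // => t _; rewrite lam0 mul0r.
  under [RHS]eq_bigr do rewrite mulr_suml.
  rewrite exchange_big /=; apply: eq_bigr => j _.
  rewrite lamWE ffunE natr_sum mulr_sumr; apply: eq_bigr => t _.
  by rewrite natrM mulrA.
- exists (fun i => g' (enum_val i)) => a.
  rewrite outDE -g'E outD_add_sum -addnA; congr (_ + _).
  rewrite big_enum /= -(big_enum_val (fun w => g' w * outD G (rep w) a)).
  rewrite [LHS](bigID (fun w => g' w < M)) /=; congr (_ + _).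
    rewrite (eq_bigl (fun w => w \in L)) => [|w]; last by rewrite LE.
    by apply: eq_bigr => w /LH wH; rewrite outrep.
  rewrite (eq_bigl (fun w => w \in U)) => [|w]; last by rewrite UE -leqNgt.
  by apply: eq_bigr => w /UH wH; rewrite outrep.
Qed.

Theorem theorem1 :
  exists c : nat,
  forall (Sigma : finType) (G : grammar Sigma),
    wf_grammar G -> regular G ->
    forall K : {ffun Sigma -> nat},
      in_out G K <->
      exists D : {ffun trans G -> nat},
        [/\ is_run G D,
            normD G D <= c * #|state G| ^ (2 * #|Sigma|) * #|Sigma|`! &
            exists (m : nat) (C : 'I_m -> {ffun trans G -> nat}),
              [/\ forall i, simple_cycle_in G (supp G D) (C i),
                  lin_indep G C &
                  exists alpha : 'I_m -> nat,
                    forall a, K a = outD G D a + \sum_i alpha i * outD G (C i) a]].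
Proof.
exists 3 => Sigma G [_ _ out1 _] regG K; split.
  case=> D [runD <-].
  (* With an empty alphabet the allowed norm is the constant 3, too small for the skeleton in
     general. All outputs then coincide, so the terminating elementary cycle alone suffices. *)
  have [k0|k_gt0] := posnP #|Sigma|.
    have [P [es [elP terP _ _]]] := run_decomposition regG runD.
    exists P; split; first exact: elementary_is_run.
      apply/bigmax_leqP => t _; rewrite k0 fact0 !muln1.
      by apply: leq_trans (elementary_le1 t elP) _.
    exists 0, (fun=> P); split; [by case|by move=> lam _ []|exists (fun=> 0) => a].
    by have := card0_eq k0 a.
  have [D' [runD' D'le cyc]] := reduced_run regG out1 runD.
  exists D'; split=> //; apply/bigmax_leqP => t _; apply: leq_trans (D'le t) _.
  by apply: norm_bound => //; apply/card_gt0P; exists (s0 G).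
case=> D [runD _ [m [C [cycC _ [alpha KE]]]]].
(* Each [C i] is a cycle from a state of the support of [D], so attaching [alpha i] copies of it
   gives a run again. *)
exists [ffun t => D t + \sum_i alpha i * C i t]; split.
  by apply: is_run_add_sum runD _ => i _; case: (cycC i).
by apply/ffunP => a; rewrite outD_add_sum KE.
Qed.
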